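(* Let $\mathcal S$ be a nonempty finite set and let $(X_i)_{1\le i\le n}$, $X_i\in\mathcal S$, be a Markov tree process defined by a directed tree $T=(V,E)$, $V=\{1,\dots,n\}$ (numbered breadth-first), and transition kernels $p_0$, $\{p_{uv}(\cdot\mid\cdot)\}_{(u,v)\in E}$. For $(u,v)\in E$ define the contraction coefficient $$\theta_{uv}=\max_{y,y'\in\mathcal S}\bigl\| p_{uv}(\cdot\mid y)-p_{uv}(\cdot\mid y')\bigr\|_{TV}.$$ Suppose that $\max_{(u,v)\in E}\theta_{uv}\le\theta<1$ for some $\theta$, and that $\operatorname{wid}(T)\le L$, where $L$ is a positive integer. Then for all $1\le i<j\le n$, $$\bar\eta_{ij}\le\bigl(1-(1-\theta)^L\bigr)^{\lfloor (j-i)/L\rfloor}.$$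
   Context: Total variation norm: for a signed measure $\tau$ on a finite set $\mathcal X$, $\|\tau\|_{TV}=\frac12\sum_{x\in\mathcal X}|\tau(x)|$. Trees: a directed tree $T=(V,E)$ is a connected directed acyclic graph in which each vertex has at most one parent ($u$ is a parent of $v$ if $(u,v)\in E$). It has a unique root (the vertex without parent). The depth $\operatorname{dep}_T(v)$ is the number of edges of the unique directed path from the root to $v$; $\operatorname{dep}(T)=\max_v \operatorname{dep}_T(v)$; $\operatorname{lev}_T(d)=\{v\in V:\operatorname{dep}_T(v)=d\}$; and $\operatorname{wid}(T)=\sup_{1\le d\le \operatorname{dep}(T)}|\operatorname{lev}_T(d)|$. Throughout, $V=\{1,\dots,n\}$ and the numbering is breadth-first: $\operatorname{dep}_T(u)<\operatorname{dep}_T(v)$ implies $u<v$. In particular the root is $1$ and every parent has a smaller number than its children. Markov tree process: given a probability distribution $p_0$ on $\mathcal S$ and, for each $(u,v)\in E$, a transition kernel $p_{uv}(\cdot\mid\cdot)$ on $\mathcal S$ (so $p_{uv}(\cdot\mid y)$ is a probability distribution on $\mathcal S$ for each $y\in\mathcal S$), $X=(X_1,\dots,X_n)$ has law $\mu(x)=p_0(x_1)\prod_{(u,v)\in E}p_{uv}(x_v\mid x_u)$ for $x\in\mathcal S^n$. Mixing coefficients: write $X_j^n=(X_j,\dots,X_n)$ and so on. For $1\le i<j\le n$, $y\in\mathcal S^{i-1}$ and $w,w'\in\mathcal S$, $$\eta_{ij}(y,w,w')=\bigl\|\mathcal L(X_j^n\mid X_1^{i-1}=y,X_i=w)-\mathcal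 L(X_j^n\mid X_1^{i-1}=y,X_i=w')\bigr\|_{TV},$$ where $\mathcal L(\cdot\mid\cdot)$ denotes conditional law, and $$\bar\eta_{ij}=\sup_{y\in\mathcal S^{i-1}}\ \sup_{w,w'\in\mathcal S}\eta_{ij}(y,w,w').$$ Conditional laws given $X_1^i=x_1^i$ are the versions given by the kernels: $\mathbb P(X_{i+1}^n=x_{i+1}^n\mid X_1^i=x_1^i)=\prod_{(u,v)\in E,\ v>i}p_{uv}(x_v\mid x_u)$, which is defined for every $x_1^i\in\mathcal S^i$; $\mathcal L(X_j^n\mid X_1^i=x_1^i)$ is the corresponding marginal. The convention $0^0=1$ is used. *)

(* Defs.v *)
From mathcomp Require Import all_boot all_order all_algebra.

Set Implicit Arguments.
Unset Strict Implicit.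
Unset Printing Implicit Defensive.

Import Order.TTheory GRing.Theory Num.Theory.
Local Open Scope ring_scope.

(* [E u v] means that (u, v) is an edge, i.e. u is a parent of v. *)

Definition is_root (V : finType) (E : rel V) (r : V) : bool :=
  [forall u, ~~ E u r].

Definition directed_tree (V : finType) (E : rel V) : Prop :=
  [/\ (0 < #|V|)%N,
      forall u v : V, connect (fun x y => E x y || E y x) u v,
      forall c : seq V, cycle E c -> c = [::]
    & forall u u' v : V, E u v -> E u' v -> u = u'].

(* In a directed tree, [dep E v] is the length of every directed path from the
   root to v (lemma [depE]).  The value 0 for vertices without such a path is
   junk; there are none in a directed tree (lemma [root_path]). *)
Definition dep (V : finType) (E : rel V) (v : V) : nat :=
  if [pick k : 'I_#|V| | [exists r, is_root E r &&
        [exists q : k.-tuple V, path E r q && (last r q == v)]]] is Some k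
  then k else 0%N.

Definition tree_dep (V : finType) (E : rel V) : nat := (\max_v dep E v)%N.

Definition lev (V : finType) (E : rel V) (d : nat) : {set V} :=
  [set v | dep E v == d].

(* The root level d = 0 is excluded. *)
Definition wid (V : finType) (E : rel V) : nat :=
  (\max_(1 <= d < (tree_dep E).+1) #|lev E d|)%N.

(* Vertices are numbered from 0; the root is [ord0] (lemma [bfs_root]). *)
Definition breadth_first (n : nat) (E : rel 'I_n) : Prop :=
  forall u v : 'I_n, (dep E u < dep E v)%N -> (u < v)%N.

Definition tv_norm (R : realFieldType) (X : finType) (tau : X -> R) : R :=
  2^-1 * \sum_x `|tau x|.

Definition is_distr (R : realFieldType) (X : finType) (q : X -> R) : Prop :=
  (forall x, 0 <= q x) /\ \sum_x q x = 1.

(* Kernels are written [k y x] for k(x | y). *)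
Definition is_kernel (R : realFieldType) (X : finType) (k : X -> X -> R)
  : Prop := forall y, is_distr (k y).

Definition contraction (R : realFieldType) (X : finType) (k : X -> X -> R)
  : R :=
  \big[Num.max/0]_(yy : X * X) tv_norm (fun x => k yy.1 x - k yy.2 x).

Definition mtp_law (R : realFieldType) (S : finType) (n : nat)
    (E : rel 'I_n.+1) (p0 : S -> R) (p : 'I_n.+1 -> 'I_n.+1 -> S -> S -> R)
    (x : {ffun 'I_n.+1 -> S}) : R :=
  p0 (x ord0) *
  \prod_(e : 'I_n.+1 * 'I_n.+1 | E e.1 e.2) p e.1 e.2 (x e.1) (x e.2).

(* P(X_v = x_v for all v > i | X_v = x_v for all v <= i) *)
Definition cond_prob (R : realFieldType) (S : finType) (n : nat)
    (E : rel 'I_n) (p : 'I_n -> 'I_n -> S -> S -> R) (i : 'I_n)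
    (x : {ffun 'I_n -> S}) : R :=
  \prod_(e : 'I_n * 'I_n | E e.1 e.2 && (i < e.2)%N)
    p e.1 e.2 (x e.1) (x e.2).

(* Values of the coordinates before i, and of the coordinates from j on. *)
Definition prefix_conf (S : finType) (n : nat) (i : 'I_n) :=
  {ffun {v : 'I_n | (v < i)%N} -> S}.
Definition suffix_conf (S : finType) (n : nat) (j : 'I_n) :=
  {ffun {v : 'I_n | (j <= v)%N} -> S}.

Definition has_prefix (S : finType) (n : nat) (i : 'I_n)
    (y : prefix_conf S i) (x : {ffun 'I_n -> S}) : bool :=
  [forall v, x (val v) == y v].
Definition has_suffix (S : finType) (n : nat) (j : 'I_n)
    (z : suffix_conf S j) (x : {ffun 'I_n -> S}) : bool :=
  [forall v, x (val v) == z v].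

(* For i < j, the mass function of the law of the coordinates from j on, given
   prefix y and X_i = w: the marginal of [cond_prob] (see lemma [cond_lawE]). *)
Definition cond_law (R : realFieldType) (S : finType) (n : nat)
    (E : rel 'I_n) (p : 'I_n -> 'I_n -> S -> S -> R) (i j : 'I_n)
    (y : prefix_conf S i) (w : S) (z : suffix_conf S j) : R :=
  \sum_(x : {ffun 'I_n -> S} |
      [&& has_prefix y x, x i == w & has_suffix z x]) cond_prob E p i x.

Definition eta (R : realFieldType) (S : finType) (n : nat)
    (E : rel 'I_n) (p : 'I_n -> 'I_n -> S -> S -> R) (i j : 'I_n)
    (y : prefix_conf S i) (w w' : S) : R :=
  tv_norm (fun z : suffix_conf S j =>
    cond_law E p y w z - cond_law E p y w' z).

Definition eta_bar (R : realFieldType) (S : finType) (n : nat)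
    (E : rel 'I_n) (p : 'I_n -> 'I_n -> S -> S -> R) (i j : 'I_n) : R :=
  \big[Num.max/0]_(y : prefix_conf S i)
    \big[Num.max/0]_(ww : S * S) eta E p j y ww.1 ww.2.

(* Adequacy of [dep] and [cond_law]. *)

Lemma root_exists (V : finType) (E : rel V) :
  directed_tree E -> exists r, is_root E r.
Proof.
case=> /card_gt0P[x0 _] _ acE _.
pose f v := #|[set u | connect E u v]|.
have [v0 _ minv0] := arg_minnP f (isT : (fun _ => true) x0).
exists v0; apply/forallP=> u; apply/negP=> Euv.
have := minv0 u isT; rewrite leqNgt => /negP; apply.
apply: proper_card; apply/properP; split.
  apply/subsetP=> w; rewrite !inE => wu.
  exact: connect_trans wu (connect1 Euv).
exists v0; first by rewrite inE.
rewrite inE; apply/negP=> /connectP[q Eq lq].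
have /acE : cycle E (v0 :: q) by rewrite /= rcons_path Eq -lq.
by [].
Qed.

Lemma root_path (V : finType) (E : rel V) (r v : V) :
  directed_tree E -> is_root E r -> exists2 q, path E r q & last r q = v.
Proof.
case=> _ conE _ parE /forallP rr.
have /connectP[s + ->] := conE r v.
elim/last_ind: s => [|s w IHs]; first by exists [::].
rewrite rcons_path last_rcons => /andP[/IHs[q Eq lq]] /orP[Ew|Ew].
  by exists (rcons q w); rewrite ?last_rcons // rcons_path Eq lq.
case/lastP: q Eq lq => [|q a] Eq /= lq.
  by rewrite -lq in Ew; have := rr w; rewrite Ew.
rewrite last_rcons in lq; move: Eq; rewrite rcons_path lq => /andP[Eq Eb].
by exists q => //; apply: parE Eb Ew.
Qed.

Lemma path_size_uniq (V : finType) (E : rel V) (r r' : V) (q q' : seq V) :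
  directed_tree E -> is_root E r -> is_root E r' ->
  path E r q -> path E r' q' -> last r q = last r' q' -> size q = size q'.
Proof.
case=> _ _ _ parE /forallP rr /forallP rr'.
elim/last_ind: q q' => [|q a IHq] q'; case/lastP: q' => [|q' a'] //=.
- by rewrite rcons_path last_rcons => _ /andP[_ +] e; rewrite -e (negPf (rr _)).
- by rewrite rcons_path last_rcons => /andP[_ +] _ e; rewrite e (negPf (rr' _)).
rewrite !rcons_path !last_rcons !size_rcons => /andP[Eq Ea] /andP[Eq' Ea'] aa.
by congr _.+1; apply: IHq => //; rewrite -aa in Ea'; apply: parE Ea Ea'.
Qed.

Lemma depE (V : finType) (E : rel V) (r : V) (q : seq V) :
  directed_tree E -> is_root E r -> path E r q -> dep E (last r q) = size q.
Proof.
move=> tE rr Eq; rewrite /dep; case: pickP => [k /existsP[r' /andP[rr']]|].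
  move=> /existsP[t /andP[Et /eqP lt]].
  by rewrite -(path_size_uniq tE rr' rr Et Eq lt) size_tuple.
have [q' Eq' [lq' uq']] :
    exists2 q', path E r q' & last r q = last r q' /\ uniq (r :: q').
  by case/shortenP: Eq => q' Eq' uq' _; exists q'.
have kV : (size q' < #|V|)%N.
  by have /= <- := card_uniqP uq'; apply: max_card.
move=> /(_ (Ordinal kV))/negbT/negP[]; apply/existsP; exists r; rewrite rr /=.
by apply/existsP; exists (in_tuple q') => /=; rewrite Eq' lq' eqxx.
Qed.

Lemma bfs_edge_lt (n : nat) (E : rel 'I_n) (u v : 'I_n) :
  directed_tree E -> breadth_first E -> E u v -> (u < v)%N.
Proof.
move=> tE bE Euv; apply: bE; have [r rr] := root_exists tE.
have [q Eq lq] := root_path u tE rr.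
have Eqv : path E r (rcons q v) by rewrite rcons_path Eq lq.
have := depE tE rr Eqv; rewrite last_rcons size_rcons => ->.
by rewrite -lq (depE tE rr Eq).
Qed.

Lemma bfs_root (n : nat) (E : rel 'I_n.+1) (r : 'I_n.+1) :
  directed_tree E -> breadth_first E -> is_root E r = (r == ord0).
Proof.
move=> tE bE.
have root0 v : is_root E v -> v = ord0.
  move=> rv; have [q Eq lq] := root_path ord0 tE rv.
  case/lastP: q Eq lq => [//|q a]; rewrite last_rcons => Eq aE.
  have := depE tE rv Eq; rewrite last_rcons size_rcons aE => d0.
  have dv : dep E v = 0%N by exact: (depE (q := [::]) tE rv isT).
  by have := bE v ord0; rewrite dv d0 => /(_ isT).
apply/idP/eqP => [/root0 //|->].
by have [r' rr'] := root_exists tE; rewrite -(root0 r' rr').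
Qed.

Lemma cond_prob_total (R : realFieldType) (S : finType) (n : nat)
    (E : rel 'I_n.+1) (p : 'I_n.+1 -> 'I_n.+1 -> S -> S -> R)
    (tE : directed_tree E) (bE : breadth_first E)
    (kp : forall u v, E u v -> is_kernel (p u v))
    (k : nat) (x0 : {ffun 'I_n.+1 -> S}) :
  (0 < k)%N ->
  \sum_(x : {ffun 'I_n.+1 -> S} | [forall v : 'I_n.+1, (v < k)%N ==> (x v == x0 v)])
    \prod_(e : 'I_n.+1 * 'I_n.+1 | E e.1 e.2 && (k <= e.2)%N)
      p e.1 e.2 (x e.1) (x e.2) = 1.
Proof.
move: {2}(n.+1 - k)%N (erefl (n.+1 - k)%N) => m.
elim: m k x0 => [|m IHm] k x0 mk k0.
  have kn : (n.+1 <= k)%N by rewrite -subn_eq0 mk.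
  rewrite (big_pred1 x0) => [|x].
    rewrite big_pred0 // => e.
    by rewrite (leqNgt k) (leq_trans (ltn_ord _) kn) andbF.
  apply/forallP/eqP => [xx|-> v]; last by rewrite eqxx implybT.
  by apply/ffunP=> v; apply/eqP; apply: (implyP (xx v)); apply: leq_trans kn.
have kn : (k < n.+1)%N by rewrite -subn_gt0 mk.
pose v := Ordinal kn.
have /existsP[u /negPn Euv] : [exists u, ~~ ~~ E u v].
  rewrite -negb_forall; have := bfs_root v tE bE; rewrite /is_root => ->.
  by rewrite -val_eqE /= -lt0n.
have uv : (u < k)%N by apply: (bfs_edge_lt tE bE Euv).
have [_ _ _ parE] := tE.
rewrite (partition_big (fun x : {ffun 'I_n.+1 -> S} => x v) xpredT) //=.
rewrite -[RHS](proj2 (kp u v Euv (x0 u))); apply: eq_bigr => s _.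
pose x1 := [ffun t => if t == v then s else x0 t].
rewrite -[RHS]mulr1 -[X in _ = _ * X](IHm k.+1 x1) //; last first.
  by rewrite subnS mk.
rewrite big_distrr /=; apply: eq_big => [x|x].
  apply/andP/forallP => [[/forallP xx /eqP xv] t|xx].
    apply/implyP; rewrite ltnS ffunE; case: (t =P v) => [-> _|/eqP tv tk].
      by rewrite xv.
    by apply: (implyP (xx t)); rewrite ltn_neqAle tk andbT.
  split.
    apply/forallP=> t; apply/implyP=> tk; have := xx t.
    rewrite ltnS (ltnW tk) ffunE; case: (t =P v) => // tv.
    by rewrite tv /= ltnn in tk.
  by have := xx v; rewrite ltnS leqnn ffunE eqxx.
move=> /andP[/forallP xx /eqP xv].
rewrite (bigD1 (u, v)) /=; last by rewrite Euv leqnn.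
rewrite xv (eqP (implyP (xx u) uv)); congr (_ * _).
apply: eq_bigl => -[a b] /=; rewrite -andbA; apply: andb_id2l => Eab.
rewrite [RHS]ltn_neqAle andbC; congr (_ && _); congr (~~ _).
rewrite xpair_eqE -[b == v]val_eqE (eq_sym k) /=.
case: (b =P k :> nat) => [bk|_]; last by rewrite andbF.
have bv : b = v by apply: val_inj.
by rewrite bv in Eab; rewrite (parE _ _ _ Eab Euv) eqxx.
Qed.

(* [cond_law] satisfies the defining equation
   P(prefix y, X_i = w) * P(suffix z | prefix y, X_i = w)
     = P(prefix y, X_i = w, suffix z)
   of conditional probability under [mtp_law]. *)
Lemma cond_lawE (R : realFieldType) (S : finType) (n : nat)
    (E : rel 'I_n.+1) (p0 : S -> R) (p : 'I_n.+1 -> 'I_n.+1 -> S -> S -> R)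
    (tE : directed_tree E) (bE : breadth_first E)
    (kp : forall u v, E u v -> is_kernel (p u v))
    (i j : 'I_n.+1) (y : prefix_conf S i) (w : S) (z : suffix_conf S j) :
  (\sum_(x | has_prefix y x && (x i == w)) mtp_law E p0 p x)
    * cond_law E p y w z =
  \sum_(x | [&& has_prefix y x, x i == w & has_suffix z x]) mtp_law E p0 p x.
Proof.
pose x0 : {ffun 'I_n.+1 -> S} :=
  [ffun v => if insub v is Some v' then y v' else w].
have prefE x : has_prefix y x && (x i == w) =
    [forall v : 'I_n.+1, (v < i.+1)%N ==> (x v == x0 v)].
  apply/andP/forallP => [[/forallP xy xi] v|xx].
    apply/implyP; rewrite ltnS leq_eqVlt ffunE => /orP[/eqP/val_inj ->|vi].
      by rewrite insubF ?ltnn.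
    by rewrite (insubT (fun v : 'I_n.+1 => (v < i)%N) vi); apply: (xy (Sub v vi)).
  split; last first.
    by have := xx i; rewrite ltnS leqnn ffunE insubF ?ltnn.
  apply/forallP=> v; have := xx (val v).
  by rewrite ltnS (ltnW (valP v)) ffunE valK.
pose C := p0 (x0 ord0) * \prod_(e : 'I_n.+1 * 'I_n.+1 |
  E e.1 e.2 && (e.2 <= i)%N) p e.1 e.2 (x0 e.1) (x0 e.2).
have lawC x : has_prefix y x && (x i == w) ->
    mtp_law E p0 p x = C * cond_prob E p i x.
  rewrite prefE => /forallP xx; have {}xx (v : 'I_n.+1) : (v <= i)%N -> x v = x0 v.
    by move=> vi; apply/eqP/(implyP (xx v)).
  rewrite /mtp_law (bigID (fun e : 'I_n.+1 * 'I_n.+1 => (e.2 <= i)%N)) /= mulrA.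
  congr (_ * _).
    rewrite xx //; congr (_ * _); apply: eq_bigr => e /andP[Ee ei].
    by rewrite !xx // (leq_trans (ltnW (bfs_edge_lt tE bE Ee)) ei).
  by apply: eq_bigl => e; rewrite ltnNge.
rewrite (eq_bigr _ lawC) -big_distrr /= (eq_bigl _ _ prefE).
rewrite (cond_prob_total tE bE kp x0 (ltn0Sn i)) mulr1 big_distrr /=.
by apply: eq_bigr => x /and3P[xy xi _]; rewrite lawC // xy.
Qed.

(* Main.v *)
(* Resample the vertices one at a time, in breadth-first order.  If two
   configurations differ on level [d], each child of a disagreeing vertex can be
   coupled so as to agree with probability at least [1 - theta], while children
   of agreeing vertices can be made to agree.  A level has at most [L] vertices,
   so a disagreement on level [d] survives on level [d + 1] with probability at
   most [q = 1 - (1 - theta) ^ L], and reaches level [dep j] with probability at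
   most [q ^ (dep j - dep i)].  Finally the vertices from [i] to [j] lie on
   [dep j - dep i + 1] levels, whence [(j - i) / L <= dep j - dep i].

   Couplings are only used for a single vertex ([coupling_bound]): what is
   propagated is a bound on the difference of the conditional expectations of a
   fixed function under two pasts. *)

Require Import Defs.
From mathcomp Require Import all_boot all_order all_algebra.
From mathcomp Require Import reals ring lra zify.

Import Order.TTheory GRing.Theory Num.Theory.
Local Open Scope ring_scope.

Set Implicit Arguments.
Unset Strict Implicit.
Unset Printing Implicit Defensive.

(** * Total variation and couplings on a finite set *)

Section Distributions.
Variables (R : realFieldType) (S : finType).
Implicit Types (f g a b : S -> R).

(** The product coupling of [a] and [b] has mass [t ^ 2]; instead of normalizing, both sides are
    multiplied by [t], which leaves [t = 0] as a separate case. *)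
Lemma weighted_diff_bound a b f g (t c : R) :
  (forall s, 0 <= a s) -> (forall s, 0 <= b s) ->
  \sum_s a s = t -> \sum_s b s = t ->
  (forall s s', `|f s - g s'| <= c) ->
  `|\sum_s a s * f s - \sum_s b s * g s| <= c * t.
Proof.
move=> a0 b0 sa sb fg.
have [t0|t0] := eqVneq t 0.
  have z (h : S -> R) : (forall s, 0 <= h s) -> \sum_s h s = t -> forall s, h s = 0.
    move=> h0 /eqP; rewrite t0 psumr_eq0 // => /allP hs s.
    by apply/eqP; apply: hs; rewrite mem_index_enum.
  rewrite !big1 ?subrr ?normr0 ?t0 ?mulr0 // => s _.
    by rewrite (z b) ?mul0r.
  by rewrite (z a) ?mul0r.
have tp : 0 < t by rewrite lt_neqAle eq_sym t0 -sa sumr_ge0.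
rewrite -(ler_pM2l tp) -{1}(gtr0_norm tp) -normrM mulrBr.
have -> : t * (\sum_s a s * f s) - t * (\sum_s b s * g s) =
    \sum_s \sum_s' a s * b s' * (f s - g s').
  rewrite -{1}sb -{1}sa !big_distrl /=.
  rewrite (eq_bigr (fun s => \sum_s' b s * (a s' * f s'))); last first.
    by move=> s _; rewrite big_distrr.
  rewrite exchange_big -sumrB; apply: eq_bigr => s _.
  by rewrite big_distrr -sumrB; apply: eq_bigr => s' _ /=; ring.
apply: le_trans (ler_norm_sum _ _ _) _.
have -> : t * (c * t) = \sum_s \sum_s' a s * b s' * c.
  under eq_bigr => s _ do rewrite -big_distrl -big_distrr /= sb.
  by rewrite -!big_distrl /= sa; ring.
apply: ler_sum => s _; apply: le_trans (ler_norm_sum _ _ _) _.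
apply: ler_sum => s' _; rewrite normrM ger0_norm ?mulr_ge0 //.
by rewrite ler_wpM2l ?mulr_ge0.
Qed.

Lemma tv_normE (p p' : S -> R) : is_distr p -> is_distr p' ->
  tv_norm (fun s => p s - p' s) = 1 - \sum_s Num.min (p s) (p' s).
Proof.
move=> [_ p1] [_ p1']; rewrite /tv_norm.
have -> : \sum_s `|p s - p' s| =
    \sum_s p s + \sum_s p' s - 2 * \sum_s Num.min (p s) (p' s).
  rewrite big_distrr /= -big_split -sumrB; apply: eq_bigr => s _ /=.
  by case: (leP (p s) (p' s)) => h; [rewrite ler0_norm|rewrite gtr0_norm]; lra.
by rewrite p1 p1'; lra.
Qed.

(* The maximal coupling of [p] and [p'] puts the mass [min p p'] on the
   diagonal and pairs the remainders arbitrarily. *)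
Lemma coupling_bound (p p' : S -> R) f g (t a r : R) :
  is_distr p -> is_distr p' -> tv_norm (fun s => p s - p' s) <= t ->
  0 <= a -> 0 <= r ->
  (forall s s', `|f s - g s'| <= a * (1 - r * (s == s')%:R)) ->
  `|\sum_s p s * f s - \sum_s p' s * g s| <= a * (1 - r * (1 - t)).
Proof.
move=> dp dp' tvt a0 r0 fg; pose m s := Num.min (p s) (p' s).
have [[p0 p1] [p0' p1']] := (dp, dp').
have m0 s : 0 <= m s by rewrite le_min p0 p0'.
set M := \sum_s m s; have tvM := tv_normE dp dp'; rewrite -/M in tvM.
have -> : \sum_s p s * f s - \sum_s p' s * g s =
    \sum_s m s * (f s - g s) +
    (\sum_s (p s - m s) * f s - \sum_s (p' s - m s) * g s).
  by rewrite -!sumrB -big_split /=; apply: eq_bigr => s _; ring.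
have diag : `|\sum_s m s * (f s - g s)| <= M * (a * (1 - r)).
  apply: le_trans (ler_norm_sum _ _ _) _; rewrite /M big_distrl /=.
  apply: ler_sum => s _; rewrite normrM ger0_norm // ler_wpM2l //.
  by have := fg s s; rewrite eqxx mulr1.
have off : `|\sum_s (p s - m s) * f s - \sum_s (p' s - m s) * g s| <=
    a * (1 - M).
  apply: weighted_diff_bound.
  - by move=> s; rewrite subr_ge0 ge_min lexx.
  - by move=> s; rewrite subr_ge0 ge_min lexx orbT.
  - by rewrite sumrB p1.
  - by rewrite sumrB p1'.
  - move=> s s'; apply: le_trans (fg s s') _.
    by rewrite ler_piMr // gerBl mulr_ge0.
apply: le_trans (ler_normD _ _) _; apply: le_trans (lerD diag off) _.
(* The two bounds add up to [a * (1 - r * M)], and [1 - M], the total variation distance, is at most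
   [t]. *)
have : 0 <= a * r * (t - (1 - M)) by rewrite !mulr_ge0 // subr_ge0 -tvM.
by lra.
Qed.

Lemma contraction_ge_tv (k : S -> S -> R) (y y' : S) :
  tv_norm (fun x => k y x - k y' x) <= contraction k.
Proof.
exact: (le_bigmax _ (fun yy => tv_norm (fun x => k yy.1 x - k yy.2 x)) (y, y')).
Qed.

End Distributions.

(** * Depths, levels and width under breadth-first numbering *)

Section TreeLevels.
Variables (n : nat) (E : rel 'I_n.+1).
Hypotheses (tE : directed_tree E) (bE : breadth_first E).
Implicit Types (u v t : 'I_n.+1).

Lemma parent_exists v : (0 < v)%N -> exists u, E u v.
Proof.
move=> v0; have := bfs_root v tE bE; rewrite -val_eqE /= gtn_eqF // /is_root.
by move/negbT; rewrite negb_forall => /existsP[u /negPn]; exists u.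
Qed.

Lemma dep_edge u v : E u v -> dep E v = (dep E u).+1.
Proof.
move=> Euv; have [r rr] := root_exists tE.
have [q Eq lq] := root_path u tE rr.
have Eqv : path E r (rcons q v) by rewrite rcons_path Eq lq.
have := depE tE rr Eqv; rewrite last_rcons size_rcons => ->.
by rewrite -lq (depE tE rr Eq).
Qed.

Lemma bfs_leq_dep u v : (u <= v)%N -> (dep E u <= dep E v)%N.
Proof. by rewrite leqNgt => uv; rewrite leqNgt; apply: contra uv; apply: bE. Qed.

Lemma card_lev_leq L v : (0 < L)%N -> (wid E <= L)%N ->
  (#|lev E (dep E v)| <= L)%N.
Proof.
move=> L0 widL; have [d0|d0] := posnP (dep E v).
  (* [wid] omits level 0, which holds only the root; there [0 < L] suffices. *)
  apply: leq_trans L0; rewrite d0 -(cards1 (ord0 : 'I_n.+1)).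
  apply/subset_leq_card/subsetP => u; rewrite !inE => /eqP du.
  rewrite -val_eqE /= -leqn0 leqNgt; apply/negP => /parent_exists[t /dep_edge].
  by rewrite du.
apply: leq_trans widL; apply: (leq_bigmax_seq (F := fun d => #|lev E d|)) => //.
by rewrite mem_index_iota d0 ltnS (leq_bigmax (F := dep E)).
Qed.

Lemma dist_div_width L u v : (0 < L)%N -> (wid E <= L)%N -> (u < v)%N ->
  ((v - u) %/ L <= dep E v - dep E u)%N.
Proof.
move=> L0 widL uv; rewrite -ltnS ltn_divLR //.
pose A := [set t : 'I_n.+1 | (u <= t <= v)%N].
have cA : #|A| = (v - u).+1.
  rewrite -sum1_card (eq_bigl (fun t : 'I_n.+1 => (u <= t < v.+1)%N)).
    rewrite -(big_ord_widen_cond n.+1 (fun t : nat => u <= t)%N (fun=> 1%N)) //.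
    rewrite -(big_mkord (fun t : nat => u <= t)%N (fun=> 1%N)).
    by rewrite -(big_nat_widenl u 0 v.+1 xpredT) //= sum_nat_const_nat muln1 subSn // ltnW.
  by move=> t; rewrite inE.
rewrite -cA.
(* On [A] the depth lies between those of [u] and [v], so [inord] does not fall back to its default
   and each fibre of [lev_of] in [A] lies on one level. *)
pose lev_of t : 'I_(dep E v - dep E u).+1 := inord (dep E t - dep E u).
rewrite -sum1_card (partition_big lev_of xpredT) //=.
rewrite -[X in (_ <= X * _)%N]card_ord -sum_nat_const; apply: leq_sum => d _.
rewrite sum1_card; set B := (X in #|X|).
have [t tB|B0] := pickP B; last by rewrite eq_card0.
have levB s : s \in B -> dep E s = (dep E u + d)%N.
  rewrite unfold_in /= inE => /andP[/andP[/bfs_leq_dep us /bfs_leq_dep sv] /eqP <-].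
  by rewrite inordK ?subnKC // ltnS leq_sub2r.
apply: leq_trans (card_lev_leq t L0 widL).
by apply/subset_leq_card/subsetP => s /levB ds; rewrite inE ds (levB t tB).
Qed.

End TreeLevels.

(** * Conditional expectations given an initial segment of vertices *)

Section ConditionalExpectation.
Variables (R : realFieldType) (S : finType) (n : nat).
Local Notation V := 'I_n.+1.
Local Notation conf := {ffun V -> S}.
Implicit Types (u v t : V) (x : conf) (f : conf -> R) (s : S) (k : nat).

Definition update x v s : conf := [ffun t => if t == v then s else x t].

Lemma update_neq x v s t : t != v -> update x v s t = x t.
Proof. by rewrite ffunE => /negPf ->. Qed.

Lemma update_eq x v s : update x v s v = s.
Proof. by rewrite ffunE eqxx. Qed.

Definition agree_below k x x' : bool := [forall v : V, (v < k)%N ==> (x v == x' v)].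

Lemma agree_belowS v s x x' :
  agree_below v.+1 x (update x' v s) = agree_below v x x' && (x v == s).
Proof.
apply/forallP/andP => [xx|[/forallP xx /eqP xv] t].
  split; last by have := xx v; rewrite ltnSn update_eq.
  apply/forallP=> t; apply/implyP=> tv; have := xx t.
  by rewrite ltnS (ltnW tv) update_neq // -val_eqE /= ltn_eqF.
apply/implyP; rewrite ltnS ffunE; have [-> _|tv tk] := eqVneq t v.
  by rewrite xv.
by apply: (implyP (xx t)); rewrite ltn_neqAle tk andbT.
Qed.

Lemma agree_below_all x x' : agree_below n.+1 x x' = (x == x').
Proof.
apply/forallP/eqP => [xx|-> v]; last by rewrite eqxx implybT.
by apply/ffunP=> v; apply/eqP/(implyP (xx v)).
Qed.

Variables (E : rel V) (p : V -> V -> S -> S -> R).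

(* The expectation of [f] given that the coordinates before [k] are those of
   [x0]. *)
Definition expect k f x0 : R :=
  \sum_(x | agree_below k x x0)
    (\prod_(e : V * V | E e.1 e.2 && (k <= e.2)%N) p e.1 e.2 (x e.1) (x e.2)) *
    f x.

Lemma expect_all f x0 : expect n.+1 f x0 = f x0.
Proof.
rewrite /expect (big_pred1 x0) => [|x]; last exact: agree_below_all.
by rewrite big_pred0 ?mul1r // => e; rewrite leqNgt ltn_ord andbF.
Qed.

Hypotheses (tE : directed_tree E) (bE : breadth_first E).

(** Tower property: sort configurations by their value at [v]. Parents being unique, only the edge
    [(u, v)] leaves the product, and [u < v] is already fixed by [x0]. *)
Lemma expect_step u v f x0 : E u v ->
  expect v f x0 = \sum_s p u v (x0 u) s * expect v.+1 f (update x0 v s).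
Proof.
move=> Euv; have uv := bfs_edge_lt tE bE Euv; have [_ _ _ parE] := tE.
rewrite /expect (partition_big (fun x : conf => x v) xpredT) //=.
apply: eq_bigr => s _; rewrite big_distrr /=.
apply: eq_big => [x|x /andP[/forallP xx /eqP xv]].
  by rewrite agree_belowS.
rewrite (bigD1 (u, v)) /=; last by rewrite Euv leqnn.
rewrite xv (eqP (implyP (xx u) uv)) -!mulrA; congr (_ * (_ * _)).
apply: eq_bigl => -[a b] /=; rewrite -andbA; apply: andb_id2l => Eab.
rewrite [RHS]ltn_neqAle andbC; congr (_ && _); congr (~~ _).
rewrite xpair_eqE -[b == v]val_eqE (eq_sym (val v)) /=.
case: (b =P v :> nat) => [/val_inj bv|_]; last by rewrite andbF.
by rewrite bv in Eab; rewrite (parE _ _ _ Eab Euv) eqxx.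
Qed.

(** * Contraction of disagreements from level to level *)

Variable theta : R.

(* Once the coordinates before [k] are revealed as [x] and [x'], the product of
   these factors bounds from below the probability that no disagreement is left
   on level [d] (nor on later revealed vertices). *)
Definition agree_factor d k x x' v : R :=
  if (v < k)%N then ((d <= dep E v)%N ==> (x v == x' v))%:R
  else if (dep E v == d) && [exists u, E u v && (x u != x' u)]
  then 1 - theta else 1.

Definition agree_prob d k x x' : R := \prod_v agree_factor d k x x' v.

Hypotheses (theta0 : 0 <= theta) (theta1 : theta < 1).

Lemma agree_factor_ge0 d k x x' v : 0 <= agree_factor d k x x' v.
Proof.
by rewrite /agree_factor; do 2?case: ifP => _; rewrite ?ler01 ?ler0n //;
   rewrite subr_ge0 ltW.
Qed.

Lemma agree_factor_le1 d k x x' v : agree_factor d k x x' v <= 1.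
Proof.
rewrite /agree_factor; do 2?case: ifP => _; rewrite ?lexx ?gerBl //.
by rewrite lern1 leq_b1.
Qed.

Lemma agree_prob_ge0 d k x x' : 0 <= agree_prob d k x x'.
Proof. by apply: prodr_ge0 => v _; apply: agree_factor_ge0. Qed.

Lemma agree_prob_le1 d k x x' : agree_prob d k x x' <= 1.
Proof.
by apply: prodr_ile1 => v _; rewrite agree_factor_ge0 agree_factor_le1.
Qed.

(** Revealing [v] could affect another factor only if [v] were the parent of a vertex on level [d],
    but such a parent has depth less than [d]. *)
Lemma agree_factor_update d u v x x' s s' t :
  (d <= dep E v)%N -> t != v ->
  agree_factor d v.+1 (update x v s) (update x' v s') t =
  agree_factor d v x x' t.
Proof.
move=> dv tv; rewrite /agree_factor !update_neq // ltnS leq_eqVlt val_eqE.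
rewrite (negPf tv) /=; case: ifP => // _; case: eqP => //= dt.
congr (if _ then _ else _); apply: eq_existsb => w.
have [Ewt|//] := boolP (E w t); rewrite !update_neq //; apply/eqP => wv;
by move: dv; rewrite -dt (dep_edge tE Ewt) wv ltnn.
Qed.

Hypothesis hp : forall u v, E u v -> is_kernel (p u v).
Hypothesis htheta : forall u v, E u v -> contraction (p u v) <= theta.
Variables (L D : nat).
Hypotheses (L0 : (0 < L)%N) (widL : (wid E <= L)%N).
Local Notation q := (1 - (1 - theta) ^+ L).

Let q_ge0 : 0 <= q.
Proof. by rewrite subr_ge0 exprn_ile1 // ?gerBl // subr_ge0 ltW. Qed.

(* The vertices before [k] comprise all levels above [d], and none below [d]
   unless [d] is the last level of interest. *)
Definition stage d k : Prop :=
  (forall v, (dep E v < d)%N -> (v < k)%N) /\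
  (d = D \/ forall v, (v < k)%N -> (dep E v <= d)%N).

(** This is where a factor [q] is gained, with exactly the levels up to [d] revealed. Agreement on
    level [d] makes both probabilities 1. Otherwise the one for [d] is 0, while the one for [d.+1]
    has at most [L] factors different from 1, each at least [1 - theta]. *)
Lemma agree_prob_next d k v x x' :
  (forall t, (t < k)%N = (dep E t <= d)%N) -> dep E v = d.+1 ->
  1 - agree_prob d.+1 k x x' <= q * (1 - agree_prob d k x x').
Proof.
move=> kd dv; have dN t : (t < k)%N -> (d < dep E t)%N = false.
  by rewrite kd ltnNge => ->.
have [/forallP agr|] := boolP [forall t, (dep E t == d) ==> (x t == x' t)].
  suff one e : (e = d) \/ (e = d.+1) -> agree_prob e k x x' = 1.
    by rewrite !one ?subrr ?mulr0; auto.
  move=> ed; rewrite /agree_prob big1 // => t _; rewrite /agree_factor kd.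
  case: leqP => td.
    have [->|->] := ed; last by rewrite ltnNge td.
    case: leqP => //= dt; rewrite (eqP (implyP (agr t) _)) ?eqxx //.
    by rewrite eqn_leq td dt.
  case: eqP => //= te; case: existsP => // -[u /andP[Eut]].
  have du : dep E u == d.
    by have := dep_edge tE Eut; move: td te; case: ed => ->; lia.
  by rewrite (eqP (implyP (agr u) du)) eqxx.
rewrite negb_forall => /existsP[t]; rewrite negb_imply => /andP[/eqP td tx].
have -> : agree_prob d k x x' = 0.
  rewrite /agree_prob (bigD1 t) //= /agree_factor kd td leqnn /= (negPf tx).
  by rewrite mul0r.
rewrite subr0 mulr1 lerD2l lerN2.
have th0 : 0 <= 1 - theta by rewrite subr_ge0 ltW.
have th1 : 1 - theta <= 1 by rewrite gerBl.
have -> : agree_prob d.+1 k x x' =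
    \prod_(t in lev E d.+1) agree_factor d.+1 k x x' t.
  rewrite /agree_prob (bigID (mem (lev E d.+1))) /= mulrC big1 ?mul1r // => w.
  rewrite inE /agree_factor kd => /negPf ->.
  by case: leqP => // wd; rewrite ltnNge wd.
apply: (@le_trans _ _ ((1 - theta) ^+ #|lev E d.+1|)).
  by rewrite ler_wiXn2l // -dv card_lev_leq.
rewrite -prodr_const; apply: ler_prod => w; rewrite inE => /eqP wd.
by rewrite /agree_factor kd wd ltnn eqxx th0 /=; case: ifP; rewrite ?lexx ?th1.
Qed.

(** [coupling_bound] is applied to the value at [v]: once [v] is revealed its own factor is the
    indicator of [s == s'], and [r] collects the unchanged factors of the other vertices. *)
Lemma expect_diff_step d v f x x' :
  (0 < v)%N -> stage d v -> (dep E v == d) || ((d == D) && (d < dep E v)%N) ->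
  (forall x x',
    `|expect v.+1 f x - expect v.+1 f x'| <=
      q ^+ (D - d) * (1 - agree_prob d v.+1 x x')) ->
  `|expect v f x - expect v f x'| <= q ^+ (D - d) * (1 - agree_prob d v x x').
Proof.
move=> v0 [_ _] dv IH; have [u Euv] := parent_exists tE bE v0.
have uv := bfs_edge_lt tE bE Euv; have duv := dep_edge tE Euv.
have dlev : (d <= dep E v)%N by case/orP: dv => [/eqP <-|/andP[_ /ltnW]].
rewrite !(expect_step _ _ Euv).
set r := \prod_(t | t != v) agree_factor d v x x' t.
(* If the parents agree, both values at [v] have the same law and total variation 0. *)
pose tau := if x u == x' u then 0 else theta.
have r0 : 0 <= r by apply: prodr_ge0 => t _; apply: agree_factor_ge0.
apply: (@le_trans _ _ (q ^+ (D - d) * (1 - r * (1 - tau)))).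
  apply: coupling_bound => //; try exact: hp; try exact: exprn_ge0.
    rewrite /tau; case: eqP => [->|_].
      by rewrite /tv_norm big1 ?mulr0 // => s _; rewrite subrr normr0.
    exact: le_trans (contraction_ge_tv _ _ _) (htheta Euv).
  move=> s s'; apply: le_trans (IH _ _) _.
  rewrite /agree_prob (bigD1 v) //= [X in _ * (1 - X) <= _]mulrC.
  under eq_bigr => t tv do rewrite agree_factor_update //.
  by rewrite /agree_factor ltnSn dlev !update_eq.
apply: ler_wpM2l; first exact: exprn_ge0.
rewrite lerD2l lerN2 /agree_prob (bigD1 v) //= [X in X <= _]mulrC -/r.
have exE : [exists w, E w v && (x w != x' w)] = (x u != x' u).
  apply/existsP/idP => [[w /andP[Ewv]]|xu]; last by exists u; rewrite Euv.
  by have [_ _ _ parE] := tE; rewrite (parE _ _ _ Ewv Euv).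
rewrite /agree_factor ltnn exE /tau; case/orP: dv => [->/=|/andP[_ ddv]].
  by case: eqP; rewrite ?subr0.
rewrite gtn_eqF //=; case: eqP => [_|/eqP xu]; first by rewrite subr0.
(* Below level [d] the factor of [v] is 1 rather than [1 - tau], but a disagreeing parent, revealed
   and of depth at least [d], already makes [r] vanish. *)
suff -> : r = 0 by rewrite !mul0r.
rewrite /r (bigD1 u) /= /agree_factor; last by rewrite -val_eqE /= ltn_eqF.
by rewrite uv -ltnS -duv ddv /= (negPf xu) mul0r.
Qed.

Lemma stage_succ v : stage (dep E v) v.+1.
Proof.
split=> [t tv|]; first exact/leqW/bE.
by right=> t; rewrite ltnS => /(bfs_leq_dep bE).
Qed.

(** Induction on the number of unrevealed vertices. The next vertex is on level [d], or deeper with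
    [d = D], or else it opens level [d.+1]; only the last case costs a factor [q]. *)
Lemma expect_diff_bound f j d k x x' :
  dep E j = D ->
  (forall x x', `|f x - f x'| <= 1 - agree_prob D n.+1 x x') ->
  (0 < k <= n.+1)%N -> (d <= D)%N -> stage d k ->
  `|expect k f x - expect k f x'| <= q ^+ (D - d) * (1 - agree_prob d k x x').
Proof.
move=> dj fb; move: {2}(n.+1 - k)%N (erefl (n.+1 - k)%N) => m.
elim: m k d x x' => [|m IHm] k d x x' mk /andP[k0 kn] dD [kd1 kd2].
  have kE : k = n.+1 by apply/eqP; rewrite eqn_leq kn -subn_eq0 mk.
  (* With everything revealed, [j] on level [D] forbids a stage with [d < D]. *)
  have -> : d = D.
    case: kd2 => // /(_ j); rewrite kE dj => /(_ (ltn_ord j)) Dd.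
    by apply/eqP; rewrite eqn_leq dD Dd.
  by rewrite kE !expect_all subnn expr0 mul1r.
have kn' : (k < n.+1)%N by rewrite -subn_gt0 mk.
pose v : V := Ordinal kn'; rewrite -[k]/(val v) in kd1 kd2 k0 *.
have step e y y' : (e <= D)%N -> stage e v ->
    (dep E v == e) || ((e == D) && (e < dep E v)%N) ->
    `|expect v f y - expect v f y'| <= q ^+ (D - e) * (1 - agree_prob e v y y').
  move=> eD [ev1 ev2] ev; apply: expect_diff_step => // z z'.
  apply: IHm => //; first by rewrite subnS mk.
  split=> [t te|]; first exact: ltnW (ev1 t te).
  case: ev2 => [|ev2]; first by left.
  case/orP: ev => [/eqP ve|/andP[/eqP]]; last by left.
  right=> t; rewrite ltnS leq_eqVlt => /orP[/eqP/val_inj ->|/ev2 //].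
  by rewrite ve.
have dv : (d <= dep E v)%N by rewrite leqNgt; apply/negP => /kd1; rewrite ltnn.
have [vd|vd] := eqVneq (dep E v) d; first by apply: step; rewrite ?vd ?eqxx.
have {}dv : (d < dep E v)%N by rewrite ltn_neqAle eq_sym vd.
have [dD'|dD'] := eqVneq d D; first by apply: step; rewrite // dD' eqxx -dD' dv orbT.
have {}dD : (d < D)%N by rewrite ltn_neqAle dD' dD.
have below t : (t < v)%N -> (dep E t <= d)%N.
  by case: kd2 => [dDe|]; [rewrite dDe eqxx in dD'|apply].
have [u Euv] := parent_exists tE bE k0.
have {}vd : dep E v = d.+1.
  apply/eqP; rewrite eqn_leq dv andbT (dep_edge tE Euv) ltnS.
  exact: below (bfs_edge_lt tE bE Euv).
have split_dep t : (t < v)%N = (dep E t <= d)%N.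
  by apply/idP/idP => [/below //|td]; apply: bE; rewrite vd.
(* The stage moves to [d.+1] before [v] is revealed. *)
apply: (@le_trans _ _ (q ^+ (D - d.+1) * (1 - agree_prob d.+1 v x x'))).
  apply: step => //; last by rewrite vd eqxx.
  split=> [t|]; first by rewrite ltnS split_dep.
  by right=> t /below/leqW.
rewrite -[(D - d)%N]prednK ?subn_gt0 // -subnS exprSr -mulrA.
by rewrite ler_wpM2l ?exprn_ge0 //; apply: agree_prob_next split_dep vd.
Qed.

End ConditionalExpectation.

(** * Mixing coefficients as differences of conditional expectations *)

Section SuffixLaw.
Variables (R : realFieldType) (S : finType) (n : nat).
Local Notation V := 'I_n.+1.
Local Notation conf := {ffun V -> S}.
Implicit Types (i j : V) (x : conf).

(** Coordinates after [i] also get the filler [w]; [expect] at [i.+1] ignores them. *)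
Definition extend i (y : prefix_conf S i) (w : S) : conf :=
  [ffun v => if insub v is Some v' then y v' else w].

Lemma extend_agree i (y : prefix_conf S i) (w : S) x :
  has_prefix y x && (x i == w) = agree_below i.+1 x (extend y w).
Proof.
apply/andP/forallP => [[/forallP xy /eqP xi] v|xx].
  apply/implyP; rewrite ltnS leq_eqVlt ffunE => /orP[/eqP/val_inj ->|vi].
    by rewrite xi insubF ?ltnn.
  by rewrite (insubT (fun v : V => (v < i)%N) vi); apply: (xy (Sub v vi)).
split; last by have := xx i; rewrite ltnSn ffunE insubF ?ltnn.
apply/forallP=> v; have := xx (val v).
by rewrite ltnS (ltnW (valP v)) ffunE valK.
Qed.

Definition suffix_of j x : suffix_conf S j := [ffun v => x (val v)].

Lemma has_suffixE j (z : suffix_conf S j) x :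
  has_suffix z x = (suffix_of j x == z).
Proof.
apply/forallP/eqP => [xz|<- v]; last by rewrite ffunE.
by apply/ffunP => v; rewrite ffunE; apply/eqP.
Qed.

Variables (E : rel V) (p : V -> V -> S -> S -> R).

Lemma sum_cond_law i j (y : prefix_conf S i) w (c : suffix_conf S j -> R) :
  \sum_z c z * cond_law E p y w z =
  expect E p i.+1 (fun x => c (suffix_of j x)) (extend y w).
Proof.
rewrite /expect (partition_big (suffix_of j) xpredT) //=.
apply: eq_bigr => z _; rewrite big_distrr /=; apply: eq_big => x.
  by rewrite andbA extend_agree has_suffixE.
by rewrite has_suffixE => /and3P[_ _ /eqP ->]; rewrite mulrC.
Qed.

(** Duality for total variation: the witness is half the sign of the difference of the two laws,
    hence of oscillation at most 1. *)
Lemma eta_expect i j (y : prefix_conf S i) w w' :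
  exists2 c : suffix_conf S j -> R, forall z z', `|c z - c z'| <= 1 &
  eta E p j y w w' =
    expect E p i.+1 (fun x => c (suffix_of j x)) (extend y w) -
    expect E p i.+1 (fun x => c (suffix_of j x)) (extend y w').
Proof.
pose delta (z : suffix_conf S j) := cond_law E p y w z - cond_law E p y w' z.
exists (fun z => 2^-1 * Num.sg (delta z)) => [z z'|].
  have c1 u : `|2^-1 * Num.sg (delta u)| <= 2^-1.
    rewrite normrM gtr0_norm ?invr_gt0 ?ltr0n // normr_sg.
    by case: (delta u == 0); rewrite ?mulr0 ?mulr1 ?invr_ge0 ?ler0n.
  by apply: le_trans (ler_normB _ _) _; have := c1 z; have := c1 z'; lra.
rewrite -!(sum_cond_law _ _ (fun z => 2^-1 * Num.sg (delta z))) -sumrB.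
rewrite /eta /tv_norm big_distrr; apply: eq_bigr => z _ /=.
by rewrite -mulrBr -mulrA -normrEsg.
Qed.

End SuffixLaw.

(** * The bound on the mixing coefficients *)

Unset Implicit Arguments.

Theorem theorem2p1 (R : realType) (S : finType) (n : nat)
    (E : rel 'I_n.+1) (p0 : S -> R) (p : 'I_n.+1 -> 'I_n.+1 -> S -> S -> R)
    (theta : R) (L : nat)
    (hS : (0 < #|S|)%N)
    (hE : directed_tree E) (hbf : breadth_first E)
    (hp0 : is_distr p0)
    (hp : forall u v : 'I_n.+1, E u v -> is_kernel (p u v))
    (htheta : \big[Num.max/0]_(e : 'I_n.+1 * 'I_n.+1 | E e.1 e.2)
                contraction (p e.1 e.2) <= theta)
    (htheta1 : theta < 1)
    (hL : (0 < L)%N) (hwid : (wid E <= L)%N) :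
  forall i j : 'I_n.+1, (i < j)%N ->
    eta_bar E p i j <= (1 - (1 - theta) ^+ L) ^+ ((j - i) %/ L)%N.
Proof.
move=> i j ij.
(* The maximum starts from 0, so this holds even without edges. *)
have theta0 : 0 <= theta by apply: le_trans htheta; apply: bigmax_ge_id.
have th u v (Euv : E u v) : contraction (p u v) <= theta.
  apply: le_trans htheta.
  exact: (le_bigmax_cond _ (fun e => contraction (p e.1 e.2)) (j := (u, v))).
have th01 : 0 <= (1 - theta) ^+ L <= 1.
  by rewrite exprn_ge0 ?exprn_ile1 ?gerBl // subr_ge0 ltW.
set q := 1 - _; have q0 : 0 <= q by rewrite subr_ge0; case/andP: th01.
have q1 : q <= 1 by rewrite gerBl; case/andP: th01.
apply: bigmax_le => [|y _]; first exact: exprn_ge0.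
apply: bigmax_le => [|[w w'] _ /=]; first exact: exprn_ge0.
apply: (@le_trans _ _ (q ^+ (dep E j - dep E i))); last first.
  by rewrite ler_wiXn2l // dist_div_width.
have [c c1 ->] := eta_expect E p j y w w'; apply: le_trans (ler_norm _) _.
apply: (@le_trans _ _ (q ^+ (dep E j - dep E i) *
    (1 - agree_prob E theta (dep E i) i.+1 (extend y w) (extend y w'))));
  last first.
  by rewrite ler_piMr ?exprn_ge0 // gerBl agree_prob_ge0.
apply: expect_diff_bound => // [x x'|||]; last exact: stage_succ.
(* Suffixes that differ do so at some [v >= j], of depth at least [dep E j], whose factor is then 0;
   so the bound to meet is 1. *)
- have [->|] := eqVneq (suffix_of j x) (suffix_of j x').
    by rewrite subrr normr0 subr_ge0 agree_prob_le1.
  rewrite -has_suffixE negb_forall => /existsP[v]; rewrite ffunE => xv.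
  rewrite /agree_prob (bigD1 (val v)) //= /agree_factor ltn_ord.
  by rewrite (bfs_leq_dep hbf (valP v)) (negPf xv) mul0r subr0.
- exact: ltn_ord.
- exact: bfs_leq_dep (ltnW ij).
Qed.
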